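(* Let $R$ be a commutative ring, let $\underline{x} = x_1,\ldots,x_k$ be an ordered sequence of elements of $R$, and let $M$ be an $R$-module. The following conditions are equivalent. (i) The sequence $\underline{x}$ is $M$-proregular. (ii) For $i=1,\ldots,k$ and any positive integer $n$ there is an integer $m\ge n$ such that $$(x_1,\ldots,x_{i-1})^mM :_M x_i^m \subseteq (x_1,\ldots,x_{i-1})^nM :_M x_i^{m-n}.$$ (iii) For $i=1,\ldots,k$ and any positive integer $n$ there is an integer $m\ge n$ such that the multiplication map $$(x_1,\ldots,x_{i-1})^mM :_M x_i^m/(x_1,\ldots,x_{i-1})^mM \xrightarrow{\ x_i^{m-n}\ } (x_1,\ldots,x_{i-1})^nM :_M x_i^n/(x_1,\ldots,x_{i-1})^nM$$ is zero.
   Context: Proregular: $\underline{x}=x_1,\ldots,x_k$ is called $M$-proregular if for every $i=1,\ldots,k$ and every positive integer $n$ there is an integer $m\ge n$ such that the map $$(x_1^m,\ldots,x_{i-1}^m)M :_M x_i^m/(x_1^m,\ldots,x_{i-1}^m)M \xrightarrow{\ x_i^{m-n}\ } (x_1^n,\ldots,x_{i-1}^n)M :_M x_i^n/(x_1^n,\ldots,x_{i-1}^n)M$$ induced by multiplication by $x_i^{m-n}$ is zero (note: ideals generated by powers of the elements); equivalently $(x_1^m,\ldots,x_{i-1}^m)M :_M x_i^m \subseteq (x_1^n,\ldots,x_{i-1}^n)M :_M x_i^{m-n}$. In (ii) and (iii), $(x_1,\ldots,x_{i-1})^m$ denotes the $m$-th power of the ideal $(x_1,\ldots,x_{i-1})R$.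 Here $N:_M y = \{u\in M : yu\in N\}$; for $i=1$ the ideals generated by the empty sequence (and their positive powers) are $0$. *)

(* Defs.v *)
From HB Require Import structures.
From mathcomp Require Import all_boot all_algebra.
From mathcomp Require Import boolp classical_sets.

Set Implicit Arguments.
Unset Strict Implicit.
Unset Printing Implicit Defensive.

Import GRing.Theory.
Import Quotient.

Local Open Scope ring_scope.
Local Open Scope quotient_scope.
Local Open Scope classical_set_scope.

(* Submodules (and ideals, i.e. submodules of R^o) are boolean predicates with
   a submodClosed structure, so that the quotients {quot N} apply; membership
   is made boolean by classical reasoning. The type idealr of ring_quotient is
   not used because it only covers proper ideals of nontrivial rings. *)

Section Submodules.
Variables (R : comPzRingType) (M : lmodType R).

Definition span (A : set M) : {pred M} :=
  [in smallest [set B : set M | submod_closed [in B]] A].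

Lemma spanP (A : set M) (u : M) :
  reflect (forall B : set M, submod_closed [in B] -> A `<=` B -> B u)
          (u \in span A).
Proof.
apply: (iffP idP) => [|H].
  by rewrite /span inE => Au B clB sAB; apply: Au; split.
by rewrite /span inE => B [clB sAB]; apply: H.
Qed.

Fact span_submod_closed A : submod_closed (span A).
Proof.
split=> [|a u v /spanP Au /spanP Av].
  by apply/spanP => B [B0 _] _; rewrite inE in B0.
apply/spanP => B clB sAB.
have := clB.2 a u v; rewrite !inE; apply; [exact: Au | exact: Av].
Qed.

HB.instance Definition _ A :=
  GRing.isSubmodClosed.Build R M (span A) (span_submod_closed A).

Lemma mem_span (A : set M) u : A u -> u \in span A.
Proof. by move=> Au; apply/spanP => B _; apply. Qed.

Lemma span_sub (A : set M) (N : submodClosed M) :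
  (forall u, A u -> u \in N) -> {subset span A <= N}.
Proof.
move=> sAN u /spanP/(_ [set` N]) H; apply: H => [|v /sAN //].
by split=> [|a v w]; rewrite !inE /=; [exact: rpred0 | move=> *; rewrite rpredD ?rpredZ].
Qed.

(* The submodule I N. *)
Definition smul (I : {pred R}) (N : {pred M}) : {pred M} :=
  span [set a *: u | a in [set` I] & u in [set` N]].

HB.instance Definition _ I N := GRing.SubmodClosed.on (smul I N).

Lemma smulS (I I' : {pred R}) (N N' : {pred M}) :
  {subset I <= I'} -> {subset N <= N'} -> {subset smul I N <= smul I' N'}.
Proof.
move=> sI sN; apply: span_sub => _ [a Ia [u Nu <-]]; apply: mem_span.
by exists a; [exact: sI | exists u; [exact: sN |]].
Qed.

(* N :_M y *)
Definition colon (N : {pred M}) (y : R) : {pred M} :=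
  [pred u | y *: u \in N].

Lemma colonE N y u : (u \in colon N y) = (y *: u \in N).
Proof. by []. Qed.

Fact colon_submod_closed (N : submodClosed M) y : submod_closed (colon N y).
Proof.
split=> [|a u v]; rewrite !inE ?scaler0 ?rpred0 //.
by move=> Nu Nv; rewrite scalerDr scalerA mulrC -scalerA rpredD // rpredZ.
Qed.

HB.instance Definition _ (N : submodClosed M) y :=
  GRing.isSubmodClosed.Build R M (colon N y) (colon_submod_closed N y).

Definition submod (L : submodClosed M) : Type := {u : M | u \in L}.

HB.instance Definition _ L := SubChoice.on (submod L).
HB.instance Definition _ (L : submodClosed M) :=
  GRing.SubChoice_isSubLmodule.Build R M (fun u => u \in L) (submod L)
    (submodClosedP L).

(* N as a subset of the type of elements of L *)
Definition rel_submod (L N : submodClosed M) : {pred submod L} :=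
  [pred u | val u \in N].

Fact rel_submod_zmod_closed L N : zmod_closed (rel_submod (L := L) N).
Proof.
split=> [|u v]; rewrite !inE ?raddf0 ?rpred0 //.
by move=> Nu Nv; rewrite raddfB; apply: (GRing.submod_closedB (submodClosedP N)).2.
Qed.

HB.instance Definition _ (L N : submodClosed M) :=
  GRing.isZmodClosed.Build (submod L) (rel_submod N)
    (rel_submod_zmod_closed L N).

(* The quotient L / N; it is only meant for N contained in L. *)
Definition subquot (L N : submodClosed M) : Type :=
  {quot (rel_submod N : {pred submod L})}.

HB.instance Definition _ L N := GRing.Zmodule.on (subquot L N).
HB.instance Definition _ L N :=
  EqQuotient.on (subquot L N).

Section MulMap.
Variables (a : R) (L N L' N' : submodClosed M).
Hypothesis aL : forall u, u \in L -> a *: u \in L'.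

Definition mul_submod (u : submod L) : submod L' :=
  Sub (a *: val u) (aL (valP u)).

(* The map L / N -> L' / N' induced by multiplication by a; by mulqE below it
   does not depend on the representatives as soon as a N is contained in N'. *)
Definition mulq (q : subquot L N) : subquot L' N' :=
  \pi_(subquot L' N') (mul_submod (repr q)).

Lemma mulqE u : (forall v, v \in N -> a *: v \in N') ->
  mulq (\pi_(subquot L N) u) = \pi_(subquot L' N') (mul_submod u).
Proof.
move=> aN; apply/eqP; rewrite -idealrBE inE raddfB /= -scalerBr; apply: aN.
have : repr (\pi_(subquot L N) u) == u %[mod subquot L N] by rewrite reprK.
by rewrite -idealrBE inE raddfB.
Qed.

End MulMap.
End Submodules.

Arguments mulq {R M a L N L' N'} aL q.

Section Ideals.
Variables (R : comPzRingType).

(* I ^ m, with I ^ 0 = R *)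
Definition idealX (I : {pred R}) (m : nat) : {pred R} :=
  iter m (fun J : {pred R^o} => smul I J) predT.

Variables (k : nat) (x : 'I_k -> R) (i : 'I_k).

(* The ideal generated by the m-th powers of the x j with j < i. *)
Definition ideal_pows (m : nat) : {pred R} :=
  span [set (x j ^+ m : R^o) | j in [set j : 'I_k | (j < i)%N]].

(* The m-th power of the ideal generated by the x j with j < i; note that
   x j ^+ 1 is convertible to x j. *)
Definition ideal_exp (m : nat) : {pred R} := idealX (ideal_pows 1) m.

Fact ideal_pows_decr n m :
  (n <= m)%N -> {subset ideal_pows m <= ideal_pows n}.
Proof.
move=> le_nm; apply: (span_sub (M := R^o) (N := span _)) => _ [j ji <-].
rewrite -(subnK le_nm) exprD; apply: (@rpredZ R R^o).
by apply: mem_span; exists j.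
Qed.

Fact ideal_exp_decr n m : (n <= m)%N -> {subset ideal_exp m <= ideal_exp n}.
Proof.
elim: n m => [|n IHn] [|m] // le_nm.
apply: (smulS (M := R^o)); [by [] | exact: IHn].
Qed.

End Ideals.

Section ColonMap.
Variables (R : comPzRingType) (M : lmodType R).

(* I M *)
Definition idealM (I : {pred R}) : {pred M} := smul I predT.

HB.instance Definition _ I := GRing.SubmodClosed.on (idealM I).

(* (I M :_M y) / I M *)
Local Notation colonq I y := (subquot (colon (idealM I) y) (idealM I)).

Variables (I : nat -> {pred R}).
Hypothesis I_decr : forall n m, (n <= m)%N -> {subset I m <= I n}.

Fact idealM_decr n m :
  (n <= m)%N -> {subset idealM (I m) <= idealM (I n)}.
Proof. by move=> le_nm; apply: (smulS (I_decr le_nm)). Qed.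

Fact colon_map_subproof (y : R) n m : (n <= m)%N ->
  forall u : M, u \in colon (idealM (I m)) (y ^+ m) ->
    y ^+ (m - n) *: u \in colon (idealM (I n)) (y ^+ n).
Proof.
move=> le_nm u; rewrite !colonE scalerA -exprD subnKC //.
exact: idealM_decr.
Qed.

(* The map  (I_m M :_M y^m) / I_m M -> (I_n M :_M y^n) / I_n M  induced by
   multiplication by y^(m-n), for a decreasing family of ideals I;
   colon_mapE says that it is well defined on classes. *)
Definition colon_map (y : R) n m (le_nm : (n <= m)%N) :
    colonq (I m) (y ^+ m) -> colonq (I n) (y ^+ n) :=
  mulq (colon_map_subproof (y := y) le_nm).

Lemma colon_mapE (y : R) n m (le_nm : (n <= m)%N) u :
  colon_map le_nm (\pi_(colonq (I m) (y ^+ m)) u) =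
  \pi_(colonq (I n) (y ^+ n))
    (mul_submod (colon_map_subproof (y := y) le_nm) u).
Proof.
apply: mulqE => v Nv; apply: rpredZ.
exact: idealM_decr le_nm v Nv.
Qed.

End ColonMap.

Arguments idealM {R} M I.
Arguments colon_map {R} M {I} I_decr y {n m} le_nm _.

Definition proregular (R : comPzRingType) (M : lmodType R) (k : nat)
    (x : 'I_k -> R) : Prop :=
  forall (i : 'I_k) (n : nat), (0 < n)%N ->
    exists (m : nat) (le_nm : (n <= m)%N),
      forall q, colon_map M (ideal_pows_decr (x := x) (i := i)) (x i) le_nm q = 0.

(* Main.v *)
(** Each condition says that, for a decreasing family of ideals [I] and [y = x i],
    every [n > 0] admits [m >= n] with [I_m M : y^m] contained in
    [I_n M : y^(m-n)].  This depends only on the cofinality class of the family,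
    and by the pigeonhole principle the powers of an ideal are cofinal with the
    ideals generated by the powers of its generators. *)

Require Import Defs.
From HB Require Import structures.
From mathcomp Require Import all_boot all_algebra.
From mathcomp Require Import boolp classical_sets.

Import GRing.Theory.
Local Open Scope ring_scope.

Section ColonMapZero.
Variables (R : comPzRingType) (M : lmodType R) (I : nat -> {pred R}).
Hypothesis I_decr : forall n m, (n <= m)%N -> {subset I m <= I n}.

(** A class of [subquot L N] vanishes iff its representative lies in [N], and every class has a
    representative, so vanishing can be tested on elements. *)
Lemma colon_map_eq0 (y : R) n m (le_nm : (n <= m)%N) :
  (forall q, colon_map M I_decr y le_nm q = 0) <->
  {subset colon (idealM M (I m)) (y ^+ m)
       <= colon (idealM M (I n)) (y ^+ (m - n))}.
Proof.
have pi_eq0 (L N : submodClosed M) (u : submod L) :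
    (\pi_(subquot L N)%qT u = 0 :> subquot L N) <-> val u \in N.
  have -> : 0 = \pi_(subquot L N)%qT 0 :> subquot L N by rewrite raddf0.
  by split=> [/eqP|Nu]; [|apply/eqP]; rewrite -Quotient.idealrBE subr0.
split=> [map0 u Lu | sub q].
  by have := map0 (\pi%qT (Sub u Lu)); rewrite colon_mapE => /pi_eq0.
by apply/pi_eq0 => /=; rewrite -colonE; apply/sub/valP.
Qed.

End ColonMapZero.

Section Cofinal.
Variables (R : comPzRingType) (M : lmodType R) (I J : nat -> {pred R}).
Hypothesis I_decr : forall n m, (n <= m)%N -> {subset I m <= I n}.
Hypothesis J_decr : forall n m, (n <= m)%N -> {subset J m <= J n}.
Hypothesis cofIJ : forall n, exists m, {subset I m <= J n}.
Hypothesis cofJI : forall n, exists m, {subset J m <= I n}.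

Lemma colon_cofinal (y : R) :
  (forall n, (0 < n)%N -> exists m, (n <= m)%N /\
     {subset colon (idealM M (I m)) (y ^+ m)
          <= colon (idealM M (I n)) (y ^+ (m - n))}) ->
  (forall n, (0 < n)%N -> exists m, (n <= m)%N /\
     {subset colon (idealM M (J m)) (y ^+ m)
          <= colon (idealM M (J n)) (y ^+ (m - n))}).
Proof.
move=> PI n n_gt0.
(* [p <= p'] puts [I p'] inside [J n]; [n <= p'] keeps the final exponent [m - p'] at most
   [m - n]. *)
have [p sIJ] := cofIJ n; pose p' := maxn n p.
have le_np' : (n <= p')%N by rewrite leq_maxl.
have [q [le_p'q sub]] := PI _ (leq_trans n_gt0 le_np').
have [r sJI] := cofJI q; pose m := maxn q r.
have le_qm : (q <= m)%N by rewrite leq_maxl.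
exists m; split=> [|u]; first exact: leq_trans le_np' (leq_trans le_p'q le_qm).
rewrite !colonE => Ju.
have Iu : y ^+ (m - q) *: u \in colon (idealM M (I q)) (y ^+ q).
  rewrite colonE scalerA -exprD subnKC //.
  apply: smulS Ju => // a /(J_decr _ _ (leq_maxr q r)); exact: sJI.
(* The exponents [q - p'] and [m - q] add up to [m - p']; the missing factor [y ^+ (p' - n)] is
   supplied afterwards. *)
have := sub _ Iu; rewrite colonE scalerA -exprD addnC addnBA // subnK // => Iu'.
have -> : (m - n = (p' - n) + (m - p'))%N.
  by rewrite addnC addnBA // subnK // (leq_trans le_p'q).
rewrite exprD -scalerA; apply: rpredZ; apply: smulS Iu' => // a.
by move/(I_decr _ _ (leq_maxr n p)); exact: sIJ.
Qed.

End Cofinal.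

Section PowersCofinal.
Variables (R : comPzRingType) (k : nat) (x : 'I_k -> R) (i : 'I_k).

Lemma ideal_pows_sub_exp n : {subset ideal_pows x i n <= ideal_exp x i n}.
Proof.
have gen_exp (j : 'I_k) : (j < i)%N -> x j ^+ n \in ideal_exp x i n.
  move=> lt_ji; elim: n => [|n IHn] //; rewrite exprS.
  apply: (mem_span (M := R^o)); exists (x j); last by exists (x j ^+ n).
  by apply: (mem_span (M := R^o)); exists j.
(* For [n = 0] the target is all of [R]; only for a successor is it a [smul], to which [span_sub]
   applies. *)
case: n gen_exp => [|n] gen_exp // a.
by apply: (span_sub (M := R^o) (N := smul _ _)) => _ [j lt_ji <-]; apply: gen_exp.
Qed.

(** The multipliers sending [b] into [N] form the ideal [colon N b], so generators suffice. *)
Lemma span_mulr (A : set R) (N : submodClosed R^o) (b : R) :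
  (forall a, A a -> a * b \in N) ->
  forall a, a \in Defs.span (M := R^o) A -> a * b \in N.
Proof.
move=> AN a Aa; rewrite mulrC.
apply: (span_sub (M := R^o) (A := A) (N := colon (M := R^o) N b)) Aa => c /AN.
by rewrite mulrC.
Qed.

(* Unequal exponents [e] make the pigeonhole argument an induction on [m]:
   splitting off a generator [x j] lowers [e j] by one. *)
Lemma ideal_exp_sub_span (e : 'I_k -> nat) m : (\sum_j e j < m)%N ->
  {subset ideal_exp x i m <=
     Defs.span (M := R^o)
       [set (x j ^+ e j : R^o) | j in [set j : 'I_k | (j < i)%N]]%classic}.
Proof.
elim: m e => [|m IHm] e // lt_em.
set J := Defs.span _.
apply: (span_sub (M := R^o) (N := J)) => _ [a Ia [b Ib <-]].
apply: span_mulr Ia => _ [j lt_ji <-].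
(* If [e j = 0], then [1] is among the generators of [J]. *)
have [ej0 | ej_gt0] := posnP (e j).
  have Jj : x j ^+ e j \in J by apply: (mem_span (M := R^o)); exists j.
  rewrite -[_ * _]mulr1; apply: (@rpredZ R R^o).
  by rewrite ej0 expr0 in Jj.
pose e' l := (e l - (l == j))%N.
have lt_e'm : (\sum_l e' l < m)%N.
  apply: leq_trans (_ : \sum_l e l <= m)%N; last by [].
  rewrite (bigD1 j) //= [X in (_ <= X)%N](bigD1 j) //=.
  rewrite /e' eqxx -addSn subn1 prednK // leq_add2l leq_sum // => l _.
  exact: leq_subr.
(* The factor [x j] restores the exponent lowered at [l = j]; the other generators already lie in
   [J]. *)
rewrite mulrC; apply: span_mulr (IHm _ lt_e'm _ Ib) => _ [l lt_li <-].
rewrite mulrC /e'; have [-> | _] := eqVneq l j.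
  by rewrite -exprS subn1 prednK //; apply: (mem_span (M := R^o)); exists j.
by rewrite subn0; apply: (@rpredZ R R^o); apply: (mem_span (M := R^o)); exists l.
Qed.

Lemma ideal_exp_cofinal n : exists m, {subset ideal_exp x i m <= ideal_pows x i n}.
Proof.
(* Among [k * n + 1] factors drawn from at most [k] generators, one occurs at least [n] times. *)
by exists (\sum_(j < k) n).+1; apply: (ideal_exp_sub_span (fun=> n)).
Qed.

Lemma ideal_pows_cofinal n : exists m, {subset ideal_pows x i m <= ideal_exp x i n}.
Proof. by exists n; apply: ideal_pows_sub_exp. Qed.

End PowersCofinal.

Theorem proposition1p2 (R : comPzRingType) (k : nat) (x : 'I_k -> R)
    (M : lmodType R) :
  [<-> (* (i) *) proregular M x;
       (* (ii) *)
       forall (i : 'I_k) (n : nat), (0 < n)%N ->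
         exists m : nat, (n <= m)%N /\
           {subset colon (idealM M (ideal_exp x i m)) (x i ^+ m)
                <= colon (idealM M (ideal_exp x i n)) (x i ^+ (m - n))};
       (* (iii) *)
       forall (i : 'I_k) (n : nat), (0 < n)%N ->
         exists (m : nat) (le_nm : (n <= m)%N), forall q,
           colon_map M (@ideal_exp_decr R k x i) (x i) le_nm q = 0].
Proof.
tfae.
- move=> pro i.
  apply: colon_cofinal (@ideal_pows_decr R k x i) (@ideal_exp_decr R k x i)
    (ideal_pows_cofinal R k x i) (ideal_exp_cofinal R k x i) (x i) _ => n n_gt0.
  by have [m [le_nm /colon_map_eq0 sub]] := pro i n n_gt0; exists m.
- move=> sub i n n_gt0; have [m [le_nm sub_m]] := sub i n n_gt0.
  by exists m, le_nm; apply/colon_map_eq0.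
- move=> map0 i n n_gt0.
  (* The transfer used for (ii), with the two families exchanged. *)
  have [|m [le_nm sub]] := colon_cofinal R M _ _
    (@ideal_exp_decr R k x i) (@ideal_pows_decr R k x i)
    (ideal_exp_cofinal R k x i) (ideal_pows_cofinal R k x i) (x i) _ n n_gt0.
    move=> p p_gt0.
    by have [m [le_pm /colon_map_eq0 sub]] := map0 i p p_gt0; exists m.
  by exists m, le_nm; apply/colon_map_eq0.
Qed.
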